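(* Let $n\ge 2$, let $$\Omega=\{(i,i): 1\le i\le n\}\cup\{(i,i-1): 2\le i\le n\}\cup\{(1,n)\},$$ and let $A_{ij}>0$ for $(i,j)\in\Omega$. Let $z^*\in\mathbb R^{2n}$ be an optimal solution of the problem $(\mathrm P)$ defined in the context, and let $\mathcal K$ be either $\mathbb S^{2n}_+$ or $\mathcal{DNN}^{2n}$. Put $$\Delta_k:=\sum_{t=2}^k\left[(z^*_{n+t})^2-(z^*_t)^2\right]\qquad(k=2,\dots,n).$$ If $$0\le\Delta_k\le (z^*_{k+1})^2\quad(k=2,\dots,n-1)\qquad\text{and}\qquad 0\le\Delta_n,$$ then for each $\theta\in\{0,1\}$ the conic relaxation $(\mathrm R_\theta)$ defined in the context admits $z^*(z^* )^T$ as a rank-one optimal solution. Consequently, the relaxation $(\mathrm R_0)$ of $(\mathrm P)$ and the relaxation $(\mathrm R_1)$ of $(\mathrm P')$ are both tight.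
   Context: $\mathbb S^s$: real symmetric $s\times s$ matrices; $\mathbb S^s_+$: positive semidefinite ones; $\mathcal{DNN}^s$: those that are positive semidefinite and elementwise nonnegative. $M\bullet N=\mathrm{trace}(MN)$. $E_{ii}=e^i(e^i)^T$ and $E_{ij}=e^i(e^j)^T+e^j(e^i)^T$ for $i\neq j$. The problems below come from completing a partially specified $n\times n$ matrix $(A_{ij})_{(i,j)\in\Omega}$ to a rank-one nonnegative matrix. $(\mathrm P)$: minimize $\sum_{i=1}^{2n}z_i^2$ over $z\in\mathbb R^{2n}$ subject to $A_{ij}-z_iz_{n+j}=0$ for $(i,j)\in\Omega$, $\sum_{i=1}^{2n}z_i^2\le r$, $z_1=1$, $z\ge 0$. $(\mathrm P')$: minimize $\sum_{i=1}^{2n}z_i^2+2\rho\sum_{(i,j)\in\Omega}z_iz_{n+j}$ over $z\in\mathbb R^{2n}$ subject to $A_{ij}-z_iz_{n+j}\le 0$ for $(i,j)\in\Omega$, $\sum_{i=1}^{2n}z_i^2\le r$, $z_1=1$, $z\ge0$. $(\mathrm R_\theta)$, $\theta\in\{0,1\}$: minimize $\big(I+\theta\rho\sum_{(i,j)\in\Omega}E_{i,n+j}\big)\bullet Z$ over $Z\in\mathcal K$ subject to $(2A_{ij}E_{11}-E_{i,n+j})\bullet Z=0$ if $\theta=0$, respectively $\le 0$ if $\theta=1$, for $(i,j)\in\Omega$; $(I-rE_{11})\bullet Z\le 0$; $Z_{11}=1$; $E_{1j}\bullet Z\ge 0$ for $j=2,\dots,2n$. $(\mathrm R_0)$ is a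 relaxation of $(\mathrm P)$ and $(\mathrm R_1)$ is a relaxation of $(\mathrm P')$. A relaxation is tight if its optimal value equals that of the problem it relaxes. $r>0$ and $\rho>0$ are fixed constants (the same in all problems) taken sufficiently large: the claim is asserted for all $r\ge r_0$ and $\rho\ge\rho_0$, for some thresholds $r_0,\rho_0>0$ depending only on $n,\Omega,A$. *)

(* Defs.v *)
From HB Require Import structures.
From mathcomp Require Import all_boot all_order all_algebra.
From mathcomp Require Import classical_sets reals constructive_ereal ereal.

Set Implicit Arguments.
Unset Strict Implicit.
Unset Printing Implicit Defensive.

Import Order.TTheory GRing.Theory Num.Theory.
Local Open Scope ring_scope.

(* A minimization problem is given by its objective [f] and feasible set [F]. *)
Definition optimal (R : realType) (T : Type) (f : T -> R) (F : set T) (x : T)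
    : Prop :=
  F x /\ forall y, F y -> f x <= f y.

(* The value is +oo if the problem is infeasible, -oo if it is unbounded. *)
Definition optval (R : realType) (T : Type) (f : T -> R) (F : set T) : \bar R :=
  ereal_inf [set (f x)%:E | x in F]%classic.

Section Matrices.
Context {R : realType} {N : nat}.

Definition mxinner (M Z : 'M[R]_N) : R := \tr (M *m Z).

Definition E (i j : 'I_N) : 'M[R]_N :=
  if i == j then delta_mx i i else delta_mx i j + delta_mx j i.

Definition psd : set 'M[R]_N :=
  [set Z | Z^T = Z /\ forall x : 'cV[R]_N, 0 <= (x^T *m Z *m x) 0 0]%classic.

Definition dnn : set 'M[R]_N :=
  [set Z | psd Z /\ forall i j, 0 <= Z i j]%classic.

Definition sqnorm (z : 'cV[R]_N) : R := \sum_i z i 0 ^+ 2.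

End Matrices.

(* The matrix to complete is n x n with n = m.+1, and indices are 0-based: the
   coordinates z_i and z_{n+j} of z in R^{2n} are those of index [lshift n i]
   and [rshift n j], with i, j : 'I_n. *)
Section Completion.
Variables (R : realType) (m : nat).
Local Notation n := m.+1.

Definition xidx (i : 'I_n) : 'I_(n + n) := lshift n i.
Definition yidx (j : 'I_n) : 'I_(n + n) := rshift n j.
Definition idx1 : 'I_(n + n) := xidx ord0.

(* The diagonal, the subdiagonal and the upper right corner. *)
Definition cycle_index : {set 'I_n * 'I_n} :=
  [set p : 'I_n * 'I_n |
    [|| p.1 == p.2,
        (p.1 == p.2.+1 :> nat) |
        (p.1 == ord0) && (p.2 == ord_max)]]%SET.

Variables (Omega : {set 'I_n * 'I_n}) (A : 'M[R]_n) (r rho : R).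

Definition objP (z : 'cV[R]_(n + n)) : R := sqnorm z.

Definition feasP : set 'cV[R]_(n + n) :=
  [set z : 'cV[R]_(n + n) | [/\ forall i j : 'I_n, (i, j) \in Omega ->
                 A i j - z (xidx i) 0 * z (yidx j) 0 = 0,
               sqnorm z <= r,
               z idx1 0 = 1 &
               forall k, 0 <= z k 0]]%classic.

Definition objP' (z : 'cV[R]_(n + n)) : R :=
  sqnorm z + 2 * rho * \sum_(p in Omega) z (xidx p.1) 0 * z (yidx p.2) 0.

Definition feasP' : set 'cV[R]_(n + n) :=
  [set z : 'cV[R]_(n + n) | [/\ forall i j : 'I_n, (i, j) \in Omega ->
                 A i j - z (xidx i) 0 * z (yidx j) 0 <= 0,
               sqnorm z <= r,
               z idx1 0 = 1 &
               forall k, 0 <= z k 0]]%classic.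

(* [theta : bool] stands for theta in {0, 1}. *)
Definition objR (theta : bool) (Z : 'M[R]_(n + n)) : R :=
  mxinner (1%:M + (theta%:R * rho) *:
             \sum_(p in Omega) E (xidx p.1) (yidx p.2)) Z.

Definition feasR (theta : bool) (K : set 'M[R]_(n + n)) :
    set 'M[R]_(n + n) :=
  [set Z : 'M[R]_(n + n) | [/\ K Z,
      forall i j : 'I_n, (i, j) \in Omega ->
        let c := mxinner ((2 * A i j) *: E idx1 idx1 - E (xidx i) (yidx j)) Z in
        if theta then is_true (c <= 0) else c = 0,
      mxinner (1%:M - r *: E idx1 idx1) Z <= 0,
      Z idx1 idx1 = 1 &
      forall j, j != idx1 -> 0 <= mxinner (E idx1 j) Z]]%classic.

(* [k : 'I_n] stands for the 1-based index k + 1. *)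
Definition Delta (z : 'cV[R]_(n + n)) (k : 'I_n) : R :=
  \sum_(t < n | (0 < t <= k)%N) (z (yidx t) 0 ^+ 2 - z (xidx t) 0 ^+ 2).

End Completion.

Arguments cycle_index m : clear implicits.

(* Main.v *)
Require Import Defs.
From HB Require Import structures.
From mathcomp Require Import all_boot all_order all_algebra.
From mathcomp Require Import classical_sets reals constructive_ereal ereal.
From mathcomp Require Import ring lra.

Set Implicit Arguments.
Unset Strict Implicit.
Unset Printing Implicit Defensive.

Import Order.TTheory GRing.Theory Num.Theory.
Local Open Scope ring_scope.

(** Optimality of the rank-one matrix is certified by nonnegative weights
    [W i j] on the edges [(i, j)] of Omega, seen as a bipartite graph on the
    coordinates of z.  Suppose that the weights around every vertex v other
    than [idx1] add up to [z v ^+ 2] ([certificate]).  Every feasible Z has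
    [Z u v >= A i j = z u * z v] on an edge from u = [xidx i] to v = [yidx j],
    for both values of theta.  Since Z is positive semidefinite, the vector
    [e_u / z u - e_v / z v] then gives
    [2 <= Z u u / z u ^+ 2 + Z v v / z v ^+ 2].  Adding these inequalities with
    the weights W, the vertex sums turn the result into [sqnorm z <= \tr Z]; the
    terms at [idx1] cancel whatever its weight sum is, because
    [Z idx1 idx1 = z idx1 ^+ 2 = 1] ([certificate_trace_bound]).  The penalty
    term of (R_1) is also minimal at z z^T, where all the edge constraints are
    equalities ([certificate_optimal]).  In terms of duality, W divided by the
    products [z u * z v] is the multiplier of the edge constraints for
    theta = 0, and adding rho to it gives the one for theta = 1; the slack
    matrix is the same weighted graph Laplacian in both cases.

    On the cycle one weight determines the others, read off one after the other
    while walking around it.  With indices counted from 1, give weight 0 to the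
    edge between y_1 and x_2, hence y_1^2 to the edge between x_1 and y_1.
    Then the walk produces the weights Delta_k and x_k^2 - Delta_(k-1)
    alternately, and their nonnegativity is the hypothesis on Delta
    ([cycle_weight_certificate]). *)

(** * Inner products and rank-one matrices *)

Section Matrices.
Variables (R : realType) (N : nat).
Implicit Types (M Z : 'M[R]_N) (z : 'cV[R]_N).

Lemma mxinnerDl M1 M2 Z : mxinner (M1 + M2) Z = mxinner M1 Z + mxinner M2 Z.
Proof. by rewrite /mxinner mulmxDl mxtraceD. Qed.

Lemma mxinnerZl c M Z : mxinner (c *: M) Z = c * mxinner M Z.
Proof. by rewrite /mxinner -scalemxAl mxtraceZ. Qed.

Lemma mxinner_suml (I : finType) (P : pred I) (F : I -> 'M[R]_N) Z :
  mxinner (\sum_(i | P i) F i) Z = \sum_(i | P i) mxinner (F i) Z.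
Proof. by rewrite /mxinner mulmx_suml raddf_sum. Qed.

Lemma mxinner1l Z : mxinner 1%:M Z = \tr Z.
Proof. by rewrite /mxinner mul1mx. Qed.

Lemma mxinner_delta i j Z : mxinner (delta_mx i j) Z = Z j i.
Proof.
rewrite /mxinner /mxtrace (bigD1 i) //= big1 ?addr0 => [|k /negPf ki].
  rewrite mxE (bigD1 j) //= big1 ?addr0 => [|l /negPf lj].
    by rewrite mxE !eqxx mul1r.
  by rewrite mxE lj andbF mul0r.
by rewrite mxE big1 // => l _; rewrite mxE ki mul0r.
Qed.

Lemma mxinner_E_diag i Z : mxinner (E i i) Z = Z i i.
Proof. by rewrite /E eqxx mxinner_delta. Qed.

Lemma mxinner_E_sym i j Z : Z^T = Z -> i != j -> mxinner (E i j) Z = 2 * Z i j.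
Proof.
move=> /matrixP /(_ i j); rewrite mxE => Zs /negPf ij.
by rewrite /E ij mxinnerDl !mxinner_delta Zs mulr_natl mulr2n.
Qed.

Lemma outerE z i j : (z *m z^T) i j = z i 0 * z j 0.
Proof. by rewrite mxE big_ord1 mxE. Qed.

Lemma mxtrace_outer z : \tr (z *m z^T) = sqnorm z.
Proof. by apply: eq_bigr => i _; rewrite outerE expr2. Qed.

Lemma psd_outer z : psd (z *m z^T).
Proof.
split=> [|x]; first by rewrite trmx_mul trmxK.
rewrite mulmxA -mulmxA mxE big_ord1.
rewrite (_ : x^T *m z = (z^T *m x)^T); last by rewrite trmx_mul trmxK.
by rewrite mxE -expr2 sqr_ge0.
Qed.

Lemma rank_outer z i : z i 0 != 0 -> \rank (z *m z^T) = 1%N.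
Proof.
move=> zi; apply/eqP; rewrite eqn_leq.
rewrite (leq_trans (mxrankM_maxl _ _) (rank_leq_col _)) /=.
rewrite lt0n mxrank_eq0; apply/negP => /eqP /matrixP /(_ i i).
by rewrite outerE mxE => /eqP; rewrite mulf_eq0 orbb (negPf zi).
Qed.

(** The quadratic form of Z at the vector [a e_u + b e_v]. *)
Lemma psd_pair Z u v (a b : R) : psd Z ->
  0 <= a ^+ 2 * Z u u + 2 * (a * b * Z u v) + b ^+ 2 * Z v v.
Proof.
case=> /matrixP /(_ u v) + /(_ (a *: delta_mx u 0 + b *: delta_mx v 0)).
rewrite mxE => Zs.
have -> : (a *: delta_mx u 0 + b *: delta_mx v 0 : 'cV[R]_N)^T =
          a *: delta_mx 0 u + b *: delta_mx 0 v.
  by rewrite linearD !linearZ /= !trmx_delta.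
rewrite !mulmxDl !mulmxDr -!scalemxAl -!scalemxAr.
have e i j : (delta_mx 0 i *m Z *m delta_mx j 0 : 'M_1) 0 0 = Z i j.
  by rewrite -rowE -colE !mxE.
rewrite !scalerA.
have eD (B C : 'M[R]_1) : (B + C) 0 0 = B 0 0 + C 0 0 by rewrite mxE.
have eZ c (B : 'M[R]_1) : (c *: B) 0 0 = c * B 0 0 by rewrite mxE.
by rewrite !(eD, eZ) !e Zs; congr (0 <= _); ring.
Qed.

End Matrices.

Lemma optval_attained (R : realType) (T : Type) (f : T -> R) (F : set T) x :
  optimal f F x -> optval f F = (f x)%:E.
Proof.
case=> Fx fmin; apply/eqP; rewrite eq_le; apply/andP; split.
  by apply: ereal_inf_lbound; exists x.
by apply: le_ereal_inf_tmp => _ [y Fy <-]; rewrite lee_fin fmin.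
Qed.

(** * Weights certifying optimality of a rank-one matrix *)

Section Certificate.
Variables (R : realType) (m : nat).
Local Notation n := m.+1.
Implicit Types (z : 'cV[R]_(n + n)) (Z : 'M[R]_(n + n)) (W : 'M[R]_n).

Lemma xidx_neq_yidx (i j : 'I_n) : xidx i != yidx j.
Proof. by rewrite eq_lrshift. Qed.

(** The row of [ord0] is left free: it belongs to the coordinate [idx1], whose
    diagonal entry in Z is fixed to 1. *)
Definition certificate z W : Prop :=
  [/\ forall i j, 0 <= W i j,
      forall i, i != ord0 -> \sum_j W i j = z (xidx i) 0 ^+ 2 &
      forall j, \sum_i W i j = z (yidx j) 0 ^+ 2].

(** Weak duality: the weighted sum of the edge inequalities
    [0 <= Z u u / z u ^+ 2 + Z v v / z v ^+ 2 - 2] is [\tr Z - sqnorm z].  They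
    come from positive semidefiniteness and the lower bound on [Z u v]. *)
Lemma certificate_trace_bound z W Z :
  (forall k, 0 < z k 0) -> z (idx1 m) 0 = 1 -> certificate z W ->
  psd Z -> Z (idx1 m) (idx1 m) = 1 ->
  (forall i j, W i j != 0 ->
     z (xidx i) 0 * z (yidx j) 0 <= Z (xidx i) (yidx j)) ->
  sqnorm z <= \tr Z.
Proof.
move=> z0 z1 [W0 Wrow Wcol] Zpsd Z1 Zge.
(* The relative excess of the diagonal entry; an edge contributes q u + q v. *)
pose q k := Z k k / z k 0 ^+ 2 - 1.
have zq k : z k 0 ^+ 2 * q k = Z k k - z k 0 ^+ 2.
  by rewrite /q; field; rewrite gt_eqF.
have edge i j : 0 <= W i j * (q (xidx i) + q (yidx j)).
  have [->|Wij] := eqVneq (W i j) 0; first by rewrite mul0r.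
  apply: mulr_ge0 => //.
  have := psd_pair (xidx i) (yidx j)
    (z (xidx i) 0)^-1 (- (z (yidx j) 0)^-1) Zpsd.
  move: (Zge _ _ Wij) (z0 (xidx i)) (z0 (yidx j)); rewrite /q.
  set a := z _ 0; set b := z _ 0; set c := Z _ (yidx j) => abc a0 b0 min.
  have c1 : 1 <= a^-1 * b^-1 * c.
    by rewrite -invfM mulrC ler_pdivlMr ?mulr_gt0 // mul1r.
  apply: (le_trans min); rewrite -subr_ge0 sqrrN !exprVn.
  rewrite (_ : _ - _ = 2 * (a^-1 * b^-1 * c - 1)); last by ring.
  by rewrite mulr_ge0 // subr_ge0.
rewrite -subr_ge0; have -> : \tr Z - sqnorm z =
    \sum_i \sum_j W i j * (q (xidx i) + q (yidx j)); last first.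
  by do 2![apply: sumr_ge0 => ? _].
transitivity (\sum_k z k 0 ^+ 2 * q k).
  by rewrite /sqnorm -sumrB; apply: eq_bigr => k _; rewrite zq.
rewrite big_split_ord /=.
under [RHS]eq_bigr => i _.
  under eq_bigr => j _ do rewrite mulrDr.
  rewrite big_split /=; over.
rewrite big_split /=; congr (_ + _); last first.
  by rewrite exchange_big; apply: eq_bigr => j _; rewrite -mulr_suml Wcol.
apply: eq_bigr => i _; rewrite -mulr_suml.
(* The excess vanishes at idx1, so its weight sum may differ from z ^+ 2. *)
have [->|i0] := eqVneq i ord0; last by rewrite Wrow.
by rewrite /q z1 Z1 expr1n divr1 subrr !mulr0.
Qed.

Section Relaxation.
Variables (Omega : {set 'I_n * 'I_n}) (A : 'M[R]_n) (r rho : R).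

Lemma objRE theta Z : psd Z ->
  objR Omega rho theta Z =
  \tr Z + 2 * (theta%:R * rho) * \sum_(p in Omega) Z (xidx p.1) (yidx p.2).
Proof.
case=> Zs _; rewrite /objR mxinnerDl mxinner1l mxinnerZl mxinner_suml.
rewrite mulrC mulr_suml [X in _ = _ + X]mulr_sumr; congr (_ + _).
by apply: eq_bigr => p _; rewrite mxinner_E_sym ?xidx_neq_yidx //; ring.
Qed.

Lemma mxinner_edge a i j Z : psd Z -> Z (idx1 m) (idx1 m) = 1 ->
  mxinner ((2 * a) *: E (idx1 m) (idx1 m) - E (xidx i) (yidx j)) Z =
  2 * (a - Z (xidx i) (yidx j)).
Proof.
case=> Zs _ Z1; rewrite -[X in _ - X]scale1r -scaleNr mxinnerDl !mxinnerZl.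
by rewrite mxinner_E_diag mxinner_E_sym ?xidx_neq_yidx // Z1; ring.
Qed.

(** The consequence common to both values of theta, from which the trace and
    the penalty term are bounded below. *)
Lemma feasR_edge theta (K : set 'M[R]_(n + n)) Z i j : psd Z ->
  feasR Omega A r theta K Z -> (i, j) \in Omega ->
  A i j <= Z (xidx i) (yidx j).
Proof.
move=> Zpsd [_ Zedge _ Z1 _] /Zedge /=; rewrite mxinner_edge //.
by case: theta {Zedge} => h; lra.
Qed.

Lemma feasR_outer (theta : bool) (K : set 'M[R]_(n + n)) z :
  K (z *m z^T) -> (forall k, 0 <= z k 0) -> sqnorm z <= r ->
  z (idx1 m) 0 = 1 ->
  (forall i j, (i, j) \in Omega ->
     let c := A i j - z (xidx i) 0 * z (yidx j) 0 in
     if theta then is_true (c <= 0) else c = 0) ->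
  feasR Omega A r theta K (z *m z^T).
Proof.
move=> Kz z0 zr z1 zedge.
have Z1 : (z *m z^T) (idx1 m) (idx1 m) = 1 by rewrite outerE z1 mulr1.
split=> // [i j /zedge||j j1] /=.
- rewrite mxinner_edge //; last exact: psd_outer.
  by rewrite outerE; case: theta {zedge} => h; [lra | rewrite h mulr0].
- rewrite -scaleNr mxinnerDl mxinnerZl mxinner1l mxinner_E_diag Z1.
  by rewrite mxtrace_outer mulr1 subr_le0.
- have [Zs _] := psd_outer z; rewrite mxinner_E_sym // 1?eq_sym //.
  by rewrite outerE !mulr_ge0.
Qed.

Lemma objR_outer theta z : objR Omega rho theta (z *m z^T) =
  objP z + 2 * (theta%:R * rho) *
    \sum_(p in Omega) z (xidx p.1) 0 * z (yidx p.2) 0.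
Proof.
rewrite objRE; last exact: psd_outer.
by rewrite mxtrace_outer; under eq_bigr do rewrite outerE.
Qed.

Lemma psd_dnn_outer (K : set 'M[R]_(n + n)) z :
  K = psd \/ K = dnn -> (forall k, 0 <= z k 0) -> K (z *m z^T).
Proof.
case=> -> z0; first exact: psd_outer.
by split=> [|i j]; [exact: psd_outer | rewrite outerE mulr_ge0].
Qed.

Lemma psd_dnn_psd (K : set 'M[R]_(n + n)) Z :
  K = psd \/ K = dnn -> K Z -> psd Z.
Proof. by case=> -> // -[]. Qed.

(** The two parts of the objective are minimized separately: the trace by the
    certificate, and each entry of the penalty term by its bound [A i j], which
    is attained at z z^T. *)
Lemma certificate_optimal theta (K : set 'M[R]_(n + n)) z W :
  0 <= rho -> K = psd \/ K = dnn ->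
  feasP Omega A r z -> (forall k, 0 < z k 0) ->
  certificate z W -> (forall i j, W i j != 0 -> (i, j) \in Omega) ->
  optimal (objR Omega rho theta) (feasR Omega A r theta K) (z *m z^T).
Proof.
move=> rho0 KE [zedge zr z1 z0] zgt0 Wcert Wsupp.
have zA i j : (i, j) \in Omega -> z (xidx i) 0 * z (yidx j) 0 = A i j.
  by move=> /zedge /eqP; rewrite subr_eq0 => /eqP.
split=> [|Z Zfeas].
  apply: feasR_outer => // [|i j /zedge]; first exact: psd_dnn_outer.
  by case: theta => /= ->.
have [KZ _ _ Z1 _] := Zfeas; have Zpsd := psd_dnn_psd KE KZ.
rewrite objR_outer objRE //; apply: lerD.
  apply: (certificate_trace_bound zgt0 z1 Wcert) => // i j /Wsupp ijO.
  by rewrite zA //; exact: feasR_edge Zfeas ijO.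
apply: ler_wpM2l; first by rewrite !mulr_ge0 ?ler0n.
apply: ler_sum => -[i j] ijO; rewrite zA //.
exact: feasR_edge Zfeas ijO.
Qed.

Lemma tight_P (K : set 'M[R]_(n + n)) z :
  optimal (@objP R m) (feasP Omega A r) z ->
  optimal (objR Omega rho false) (feasR Omega A r false K) (z *m z^T) ->
  optval (objR Omega rho false) (feasR Omega A r false K)
    = optval (@objP R m) (feasP Omega A r).
Proof.
move=> zopt Zopt; rewrite (optval_attained zopt) (optval_attained Zopt).
by rewrite objR_outer mul0r mulr0 mul0r addr0.
Qed.

(** Every feasible point of P' lifts to R_1 with the same objective value, and z
    itself is feasible for P'; hence optimality of z z^T descends to z. *)
Lemma tight_P' (K : set 'M[R]_(n + n)) z :
  K = psd \/ K = dnn -> feasP Omega A r z ->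
  optimal (objR Omega rho true) (feasR Omega A r true K) (z *m z^T) ->
  optval (objR Omega rho true) (feasR Omega A r true K)
    = optval (objP' Omega rho) (feasP' Omega A r).
Proof.
move=> KE [zedge zr z1 z0] zopt.
have objE x : objR Omega rho true (x *m x^T) = objP' Omega rho x.
  by rewrite objR_outer mul1r.
rewrite (optval_attained zopt) objE.
apply/esym/optval_attained; split.
  by split=> // i j /zedge ->.
move=> x [xedge xr x1 x0]; rewrite -!objE; apply: zopt.2.
by apply: feasR_outer => //; exact: psd_dnn_outer.
Qed.

End Relaxation.
End Certificate.

(** * The weights on the cycle *)

Section Cycle.
Variables (R : realType) (m : nat).
Local Notation n := m.+2.
Implicit Types (z : 'cV[R]_(n + n)) (i j k : 'I_n).

(** Column j has two edges: the diagonal one and the one to the cyclic successor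
    of j, whose value is [ord0] for the last column.  Splitting [y_j ^+ 2] as
    below makes the column sums automatic, and the recursion for [Delta] turns
    the diagonal weight into [x_j ^+ 2 - Delta_(j-1)] away from column 0, which
    makes the row sums right. *)
Definition cycle_weight z : 'M[R]_n := \matrix_(i, j)
  ((i == j)%:R * (z (yidx j) 0 ^+ 2 - Delta z j)
   + (i == ordS j)%:R * Delta z j).

Lemma cycle_weight_supp z i j :
  cycle_weight z i j != 0 -> (i, j) \in cycle_index m.+1.
Proof.
rewrite mxE inE /=; have [//|_] := eqVneq i j; rewrite mul0r add0r /=.
have [->|_] := eqVneq i (ordS j); last by rewrite mul0r eqxx.
move=> _; have := ltn_ord j; rewrite leq_eqVlt => /orP[/eqP jn|jn].
  apply/orP; right; apply/andP; split; apply/eqP/val_inj => /=.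
    by rewrite jn modnn.
  by case: jn.
by rewrite /= modn_small ?eqxx.
Qed.

Lemma Delta0 z : Delta z ord0 = 0.
Proof. by rewrite /Delta big_pred0 // => t /=; case: (t : nat). Qed.

Lemma Delta_rec z i j : j = i.+1 :> nat ->
  Delta z j = Delta z i + (z (yidx j) 0 ^+ 2 - z (xidx j) 0 ^+ 2).
Proof.
move=> ji; rewrite /Delta (bigD1 j) /=; last by rewrite ji leqnn.
rewrite addrC; congr (_ + _); apply: eq_bigl => t.
by rewrite -val_eqE /= ji -andbA [X in _ && X]andbC -ltn_neqAle ltnS.
Qed.

Lemma ord_pred_val i : i != ord0 -> i = (ord_pred i).+1 :> nat.
Proof.
rewrite -val_eqE -lt0n /= => i0.
rewrite -subn1 -addnBAC // subn1 modnDr modn_small ?prednK //.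
by rewrite (leq_trans _ (ltn_ord i)) ?prednK.
Qed.

Lemma sum_indicator (F : 'I_n -> R) k : \sum_i (i == k)%:R * F i = F k.
Proof.
rewrite (bigD1 k) //= eqxx mul1r big1 ?addr0 // => i /negPf->.
by rewrite mul0r.
Qed.

(** The hypotheses on [Delta] say that the weights are nonnegative, apart from
    those at the indices 0 and 1 that reduce to squares because [Delta]
    vanishes at [ord0]. *)
Lemma cycle_weight_certificate z :
  (forall k (l : 'I_n), (0 < k)%N -> l = k.+1 :> nat ->
     0 <= Delta z k <= z (xidx l) 0 ^+ 2) ->
  0 <= Delta z ord_max ->
  certificate z (cycle_weight z).
Proof.
move=> Dk Dn.
have pos_ord j : j != ord0 -> (0 < j)%N by rewrite -val_eqE lt0n.
have D_ge0 j : 0 <= Delta z j.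
  have [->|j0] := eqVneq j ord0; first by rewrite Delta0.
  have [->//|jm] := eqVneq j ord_max.
  have jn : (j.+1 < n)%N.
    rewrite ltn_neqAle ltn_ord andbT; apply: contra jm => /eqP[jm].
    exact/eqP/val_inj.
  by have /andP[] := Dk j (Ordinal jn) (pos_ord _ j0) erefl.
have D_le j : 0 <= z (yidx j) 0 ^+ 2 - Delta z j.
  have [->|j0] := eqVneq j ord0; first by rewrite Delta0 subr0 sqr_ge0.
  have pj := ord_pred_val j0.
  rewrite (Delta_rec z pj)
    (_ : _ - _ = z (xidx j) 0 ^+ 2 - Delta z (ord_pred j)); last by ring.
  rewrite subr_ge0; have [e|p0] := eqVneq (ord_pred j) ord0.
    by rewrite e Delta0 sqr_ge0.
  by have /andP[] := Dk (ord_pred j) j (pos_ord _ p0) pj.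
split=> [i j|i i0|j].
- by rewrite mxE addr_ge0 // mulr_ge0.
- have predS j : (i == ordS j) = (j == ord_pred i).
    by rewrite [RHS]eq_sym (can2_eq (@ord_predK _) (@ordSK _)).
  under eq_bigr => j _ do rewrite mxE predS (eq_sym i j).
  rewrite big_split /= !sum_indicator (Delta_rec z (ord_pred_val i0)); ring.
- under eq_bigr do rewrite mxE.
  by rewrite big_split /= !sum_indicator subrK.
Qed.

End Cycle.

(* The size n >= 2 is m.+2. *)
Theorem theorem4p9 (R : realType) (m : nat) (A : 'M[R]_(m.+2))
    (hA : forall i j : 'I_(m.+2), (i, j) \in cycle_index m.+1 -> 0 < A i j) :
  exists r0 rho0 : R, 0 < r0 /\ 0 < rho0 /\
  forall r rho : R, r0 <= r -> rho0 <= rho ->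
  forall (zs : 'cV[R]_(m.+2 + m.+2)) (K : set 'M[R]_(m.+2 + m.+2)),
  let Omega := cycle_index m.+1 in
  optimal (@objP R m.+1) (feasP Omega A r) zs ->
  K = psd \/ K = dnn ->
  (forall k l : 'I_(m.+2), (0 < k)%N -> l = k.+1 :> nat ->
     0 <= Delta zs k <= zs (xidx l) 0 ^+ 2) ->
  0 <= Delta zs ord_max ->
  (forall theta : bool,
     \rank (zs *m zs^T) = 1%N /\
     optimal (objR Omega rho theta) (feasR Omega A r theta K) (zs *m zs^T)) /\
  optval (objR Omega rho false) (feasR Omega A r false K)
    = optval (@objP R m.+1) (feasP Omega A r) /\
  optval (objR Omega rho true) (feasR Omega A r true K)
    = optval (objP' Omega rho) (feasP' Omega A r).
Proof.
(* The bound sqnorm zs <= r is part of the feasibility of zs, and the certificate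
   works as soon as 0 <= rho. *)
exists 1, 1; do 2![split=> //]; move=> r rho _ rho1 zs K Omega zopt KE Dk Dn.
have rho0 : 0 <= rho := le_trans ler01 rho1.
have [zfeas _] := zopt; have [zedge _ z1 z0] := zfeas.
have z_neq0 i j : (i, j) \in Omega ->
    (zs (xidx i) 0 != 0) && (zs (yidx j) 0 != 0).
  move=> ijO; rewrite -negb_or -mulf_eq0.
  by move/eqP: (zedge _ _ ijO); rewrite subr_eq0 => /eqP <-; rewrite gt_eqF ?hA.
(* The diagonal belongs to Omega, so every coordinate lies on some edge. *)
have zgt0 k : 0 < zs k 0.
  rewrite lt0r z0 andbT -[k]splitK; case: (split k) => i /=.
    by have /andP[] := z_neq0 i i ltac:(by rewrite inE eqxx).
  by have /andP[] := z_neq0 i i ltac:(by rewrite inE eqxx).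
have opt theta : optimal (objR Omega rho theta) (feasR Omega A r theta K)
    (zs *m zs^T).
  apply: certificate_optimal (cycle_weight_certificate Dk Dn) _ => // i j.
  exact: cycle_weight_supp.
split=> [theta|]; first by rewrite (rank_outer (i := idx1 m.+1)) ?z1 ?oner_neq0.
by split; [exact: tight_P (opt false) | exact: tight_P' (opt true)].
Qed.
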